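(* Let $q$ be a prime power and let $\lambda=(k,k-1,\dots,2,1)$ be a staircase, $k\geq 1$. Then, under a uniformly random ring homomorphism $\Lambda\to\mathbb{F}_q$, $P(s_\lambda\mapsto 0)=1/q$.
   Context: $\Lambda$ is the ring of symmetric functions over $\mathbb{Z}$, $h_k$ the complete homogeneous symmetric functions, $s_\lambda$ the Schur functions. A uniformly random ring homomorphism $\Lambda\to\mathbb{F}_q$ is obtained by sending $h_1,h_2,\dots$ to independent uniformly random elements of $\mathbb{F}_q$. *)

(* Defs.v *)
From HB Require Import structures.
From mathcomp Require Import all_boot all_fingroup all_algebra.
From mathcomp Require Import zify.
From mathcomp Require boolp mpoly.
From mathcomp Require all_classical all_reals all_analysis.

Set Implicit Arguments.
Unset Strict Implicit.
Unset Printing Implicit Defensive.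

Import GRing.Theory.
Local Open Scope ring_scope.

Module SymmetricFunctions.
Import boolp mpoly.

(* The ring of symmetric functions is built as the inverse limit, in the
   category of graded rings, of the rings of symmetric polynomials in n
   variables over the integers: a symmetric function f is a family of symmetric
   polynomials f(x_1, ..., x_n) of bounded degree, compatible with the maps that
   set the last variable to 0. *)

Definition restr n (p : {mpoly int[n.+1]}) : {mpoly int[n]} :=
  p \mPo [tuple if unlift ord_max i is Some j then 'X_j else 0 | i < n.+1].

Definition is_symfun (t : forall n, {mpoly int[n]}) : Prop :=
  [/\ forall n, t n \is symmetric,
      forall n, restr (t n.+1) = t n
    & exists d, forall n, (msize (t n) <= d)%N].

Record symfun := SymFun {
  symfun_poly : forall n, {mpoly int[n]};
  symfun_polyP : is_symfun symfun_poly }.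

Lemma symfun_poly_sym f n : symfun_poly f n \is symmetric.
Proof. by have [] := symfun_polyP f. Qed.

Lemma symfun_poly_restr f n : restr (symfun_poly f n.+1) = symfun_poly f n.
Proof. by have [] := symfun_polyP f. Qed.

Lemma symfun_poly_bounded f : exists d, forall n, (msize (symfun_poly f n) <= d)%N.
Proof. by have [] := symfun_polyP f. Qed.

Lemma symfun_eqP (f g : symfun) : (forall n, symfun_poly f n = symfun_poly g n) -> f = g.
Proof.
case: f g => [f fP] [g gP] /= fg.
have {fg} fg : f = g by apply: functional_extensionality_dep.
by case: _ / fg in gP *; congr SymFun; apply: Prop_irrelevance.
Qed.

HB.instance Definition _ := gen_eqMixin symfun.
HB.instance Definition _ := gen_choiceMixin symfun.

Lemma symfun_poly_bounded2 f g : exists d, forall n,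
  (msize (symfun_poly f n) <= d)%N /\ (msize (symfun_poly g n) <= d)%N.
Proof.
have [d df] := symfun_poly_bounded f; have [e eg] := symfun_poly_bounded g.
by exists (maxn d e) => n; rewrite !leq_max df eg orbT.
Qed.

Lemma symfun0_subproof : is_symfun (fun n => 0).
Proof.
split=> [n|n|]; [exact: rpred0|by rewrite /restr comp_mpoly0|].
by exists 0%N => n; rewrite msize0.
Qed.

Lemma symfun1_subproof : is_symfun (fun n => 1).
Proof.
split=> [n|n|]; [exact: rpred1|by rewrite /restr comp_mpoly1|].
by exists 1%N => n; rewrite msize1.
Qed.

Lemma symfun_opp_subproof f : is_symfun (fun n => - symfun_poly f n).
Proof.
split=> [n|n|]; first by rewrite rpredN symfun_poly_sym.
  by rewrite -(symfun_poly_restr f n) /restr comp_mpolyN.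
by have [d df] := symfun_poly_bounded f; exists d => n; rewrite msizeN.
Qed.

Lemma symfun_add_subproof f g : is_symfun (fun n => symfun_poly f n + symfun_poly g n).
Proof.
split=> [n|n|]; first by rewrite rpredD ?symfun_poly_sym.
  by rewrite -(symfun_poly_restr f n) -(symfun_poly_restr g n) /restr comp_mpolyD.
have [d dfg] := symfun_poly_bounded2 f g; exists d => n.
by apply: leq_trans (msizeD_le _ _) _; rewrite geq_max; apply/andP; case: (dfg n).
Qed.

Lemma symfun_mul_subproof f g : is_symfun (fun n => symfun_poly f n * symfun_poly g n).
Proof.
split=> [n|n|]; first by rewrite rpredM ?symfun_poly_sym.
  by rewrite -(symfun_poly_restr f n) -(symfun_poly_restr g n) /restr rmorphM.
have [d dfg] := symfun_poly_bounded2 f g; exists (d + d).+1%N => n.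
apply: leq_trans (msizeM_le _ _) _; case: (dfg n) => df dg.
by rewrite ltnS leq_add.
Qed.

Definition symfun0 := SymFun symfun0_subproof.
Definition symfun1 := SymFun symfun1_subproof.
Definition symfun_opp f := SymFun (symfun_opp_subproof f).
Definition symfun_add f g := SymFun (symfun_add_subproof f g).
Definition symfun_mul f g := SymFun (symfun_mul_subproof f g).

Lemma symfun_addA : associative symfun_add.
Proof. by move=> f g k; apply: symfun_eqP => n /=; rewrite addrA. Qed.
Lemma symfun_addC : commutative symfun_add.
Proof. by move=> f g; apply: symfun_eqP => n /=; rewrite addrC. Qed.
Lemma symfun_add0 : left_id symfun0 symfun_add.
Proof. by move=> f; apply: symfun_eqP => n /=; rewrite add0r. Qed.
Lemma symfun_addN : left_inverse symfun0 symfun_opp symfun_add.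
Proof. by move=> f; apply: symfun_eqP => n /=; rewrite addNr. Qed.

HB.instance Definition _ := GRing.isZmodule.Build symfun
  symfun_addA symfun_addC symfun_add0 symfun_addN.

Lemma symfun_mulA : associative symfun_mul.
Proof. by move=> f g k; apply: symfun_eqP => n /=; rewrite mulrA. Qed.
Lemma symfun_mulC : commutative symfun_mul.
Proof. by move=> f g; apply: symfun_eqP => n /=; rewrite mulrC. Qed.
Lemma symfun_mul1 : left_id symfun1 symfun_mul.
Proof. by move=> f; apply: symfun_eqP => n /=; rewrite mul1r. Qed.
Lemma symfun_mulD : left_distributive symfun_mul +%R.
Proof. by move=> f g k; apply: symfun_eqP => n /=; rewrite mulrDl. Qed.
Lemma symfun_1neq0 : symfun1 != 0.
Proof.
by apply/eqP => /(congr1 (symfun_poly^~ 0%N)) /= /eqP; rewrite oner_eq0.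
Qed.

HB.instance Definition _ := GRing.Zmodule_isComNzRing.Build symfun
  symfun_mulA symfun_mulC symfun_mul1 symfun_mulD symfun_1neq0.

Definition symfun_proj n (f : symfun) := symfun_poly f n.

Lemma symfun_proj_zmod n : zmod_morphism (symfun_proj n). Proof. by []. Qed.
Lemma symfun_proj_monoid n : monoid_morphism (symfun_proj n). Proof. by []. Qed.

HB.instance Definition _ n :=
  GRing.isZmodMorphism.Build symfun {mpoly int[n]} (symfun_proj n) (symfun_proj_zmod n).
HB.instance Definition _ n :=
  GRing.isMonoidMorphism.Build symfun {mpoly int[n]} (symfun_proj n)
    (symfun_proj_monoid n).

Definition hsym_poly n k : {mpoly int[n]} :=
  \sum_(m : 'X_{1..n < k.+1} | mdeg m == k) 'X_[m].

Lemma mcoeff_hsym n k m : (hsym_poly n k)@_m = (mdeg m == k)%:R.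
Proof.
rewrite /hsym_poly raddf_sum /=.
under eq_bigr do rewrite mcoeffX.
have [mk|mk] := eqVneq (mdeg m) k.
  have mk1 : (mdeg m < k.+1)%N by rewrite mk.
  rewrite (bigD1 (BMultinom mk1)) /= ?mk // eqxx big1 ?addr0 // => i /andP[_].
  by rewrite bmeqP /= => /negPf ->.
by rewrite big1 // => i /eqP ik; case: eqP => // im; rewrite -im ik eqxx in mk.
Qed.


Definition mnmup n (m : 'X_{1..n}) : 'X_{1..n.+1} :=
  [multinom (if unlift ord_max i is Some j then m j else 0%N) | i < n.+1].

Lemma mcoeff_restr n (p : {mpoly int[n.+1]}) m : (restr p)@_m = p@_(mnmup m).
Proof.
rewrite /restr comp_mpolyEX [in RHS](mpolyE p) !raddf_sum /=; apply: eq_bigr => k _.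
rewrite !mcoeffZ; congr (_ * _); rewrite comp_mpolyX mcoeffX.
rewrite (bigD1_ord ord_max) //= tnth_mktuple unlift_none.
under eq_bigr do rewrite tnth_mktuple liftK.
pose k' := [multinom k (lift ord_max i) | i < n].
have -> : \prod_(i < n) ('X_i ^+ k (lift ord_max i) : {mpoly int[n]}) = 'X_[k'].
  by rewrite [RHS]mpolyXE_id; apply: eq_bigr => i _; rewrite mnmE.
have [k0|k0] := eqVneq (k ord_max) 0%N; last first.
  rewrite expr0n (negPf k0) mul0r mcoeff0; case: eqP => // km.
  by rewrite km mnmE unlift_none in k0.
rewrite k0 expr0 mul1r mcoeffX; congr (nat_of_bool _)%:R.
apply/eqP/eqP => [<-|kE].
  by apply/mnmP => i; rewrite !mnmE; case: unliftP => [j|] ->; rewrite ?mnmE.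
by apply/mnmP => i; rewrite mnmE kE mnmE liftK.
Qed.

Lemma mdeg_mnmup n (m : 'X_{1..n}) : mdeg (mnmup m) = mdeg m.
Proof.
rewrite !mdegE (bigD1_ord ord_max) //= mnmE unlift_none add0n.
by apply: eq_bigr => i _; rewrite mnmE liftK.
Qed.

Lemma hsym_subproof k : is_symfun (fun n => hsym_poly n k).
Proof.
split=> [n|n|].
- apply/issymP => s; apply/mpolyP => m.
  by rewrite mcoeff_sym !mcoeff_hsym mdeg_mperm.
- by apply/mpolyP => m; rewrite mcoeff_restr !mcoeff_hsym mdeg_mnmup.
exists k.+1 => n; rewrite msizeE; apply/bigmax_leqP_seq => m.
rewrite mcoeff_msupp mcoeff_hsym => + _.
by have [->|] := eqVneq (mdeg m) k; rewrite ?eqxx.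
Qed.

Definition hsym k : symfun := SymFun (hsym_subproof k).

(* The alternant a_(lam + delta) = det (x_i ^ (lam_j + n - j))_(1 <= i, j <= n);
   indices are 0-based below, and a_delta is alternant n [::]. *)
Definition alternant n (lam : seq nat) : {mpoly int[n]} :=
  \det (\matrix_(i < n, j < n) 'X_i ^+ (nth 0%N lam j + (n - j.+1))).

(* f is the Schur function of lam: f(x_1, ..., x_n) = a_(lam + delta) / a_delta
   for all n >= l(lam). Such an f exists and is unique: see schur_subproof
   and is_schur_inj below. *)
Definition is_schur (lam : seq nat) (f : symfun) : Prop :=
  forall n, (size lam <= n)%N ->
    symfun_poly f n * alternant n [::] = alternant n lam.

(* Existence follows from the Jacobi-Trudi identity
   alternant n lam = det (h_(lam_i - i + j)) * alternant n [::], which rests on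
   (\sum_k h_k T^k) * \prod_(q != p) (1 - x_q T) = \sum_k x_p^k T^k. *)
Section SchurExistence.

Section Variables.
Variable n : nat.
Implicit Types (S : {set 'I_n}) (m : 'X_{1..n}).

Definition hsub S k : {mpoly int[n]} :=
  \sum_(m : 'X_{1..n < k.+1} | (mdeg m == k) && [forall i, (i \notin S) ==> (m i == 0%N)])
    'X_[m].

Lemma mcoeff_hsub S k m :
  (hsub S k)@_m = ((mdeg m == k) && [forall i, (i \notin S) ==> (m i == 0%N)])%:R.
Proof.
rewrite /hsub raddf_sum /=.
under eq_bigr do rewrite mcoeffX.
have [mk|mk] := boolP (_ && _).
  have mk1 : (mdeg m < k.+1)%N by case/andP: mk => /eqP ->.
  rewrite (bigD1 (BMultinom mk1)) /= ?mk // eqxx big1 ?addr0 // => i /andP[_].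
  by rewrite bmeqP /= => /negPf ->.
by rewrite big1 // => i ik; case: eqP => // im; rewrite -im ik in mk.
Qed.

Lemma hsubT k : hsub setT k = hsym_poly n k.
Proof.
apply/mpolyP => m; rewrite mcoeff_hsub mcoeff_hsym.
by case: forallP => [_|[]]; rewrite ?andbT // => i; rewrite inE.
Qed.

Lemma hsub0 S : hsub S 0 = 1.
Proof.
apply/mpolyP => m; rewrite mcoeff_hsub mcoeff1 mdeg_eq0.
by case: eqP => //= ->; case: forallP => // -[] i; rewrite mnm0E eqxx implybT.
Qed.

Lemma hsub_set0 k : hsub set0 k.+1 = 0.
Proof.
apply/mpolyP => m; rewrite mcoeff_hsub mcoeff0.
case: eqP => //= mk; case: forallP => // m0; move: mk.
by rewrite mdegE big1 // => i _; apply/eqP; have := m0 i; rewrite inE.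
Qed.

Lemma mcoeffMXU (p : {mpoly int[n]}) i m :
  (p * 'X_i)@_m = if m i == 0%N then 0 else p@_(m - U_(i))%MM.
Proof.
case: ifPn => [m0|m0].
  apply/eqP; rewrite mcoeff_eq0 (perm_mem (msuppMX _ _)); apply/mapP => -[k _ mE].
  by rewrite mE mnmDE mnm1E eqxx in m0.
have {1}-> : m = (U_(i) + (m - U_(i)))%MM by rewrite addmC submK // lep1mP.
exact: mcoeffMX.
Qed.

Lemma hsubU S q k : q \notin S ->
  hsub (q |: S) k.+1 = hsub S k.+1 + 'X_q * hsub (q |: S) k.
Proof.
move=> qS; apply/mpolyP => m; rewrite mcoeffD mulrC mcoeffMXU !mcoeff_hsub.
case: ifPn => mq.
  rewrite addr0; congr (nat_of_bool (_ && _))%:R; apply/forallP/forallP => m0 i.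
    apply/implyP => iS; have := m0 i; rewrite !inE negb_or iS andbT.
    by case: eqP => [->|].
  by apply/implyP; rewrite !inE negb_or => /andP[_]; apply/implyP.
have mE : m = (U_(q) + (m - U_(q)))%MM by rewrite addmC submK // lep1mP.
have -> : [forall i, (i \notin S) ==> (m i == 0%N)] = false.
  by apply/forallP => /(_ q); rewrite qS (negPf mq).
rewrite andbF add0r; congr (nat_of_bool (_ && _))%:R.
  by rewrite {1}mE mdegD mdeg1 add1n eqSS.
apply: eq_forallb => i; rewrite !inE mnmBE mnm1E eq_sym.
by case: eqP; rewrite //= subn0.
Qed.

Definition conv (C : {poly {mpoly int[n]}}) (u : nat -> {mpoly int[n]}) k :=
  \sum_(t < k.+1) C`_t * u (k - t)%N.

Definition Dx x (u : nat -> {mpoly int[n]}) k :=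
  if k is k'.+1 then u k - x * u k' else u 0%N.

Lemma conv_Dx x C u k : conv ((1 - x *: 'X) * C) u k = conv C (Dx x u) k.
Proof.
rewrite /conv.
under eq_bigr => t _ do rewrite mulrBl mul1r -scalerAl coefB coefZ coefXM mulrBl.
rewrite sumrB [X in X - _]big_ord_recr /= [X in _ - X]big_ord_recl /=.
rewrite mulr0 mul0r add0r [RHS]big_ord_recr /= subnn addrAC; congr (_ + _).
rewrite -sumrB; apply: eq_bigr => t _; rewrite /bump /= add1n subnS /Dx.
have : (0 < k - t)%N by rewrite subn_gt0.
by case: (k - t)%N => //= l _; rewrite mulrBr mulrCA mulrA.
Qed.

Lemma conv_hsub (s : seq 'I_n) S k : uniq s -> [disjoint s & S] ->
  conv (\prod_(q <- s) (1 - 'X_q *: 'X)) (hsub (S :|: [set:: s])) k = hsub S k.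
Proof.
elim: s S k => [|q s IHs] S k /=.
  move=> _ _; rewrite big_nil /conv big_ord_recl coef1 mul1r subn0 big1 ?addr0.
    by congr hsub; apply/setP => i; rewrite !inE orbF.
  by move=> i _; rewrite coef1 mul0r.
case/andP=> qs us; rewrite disjoint_cons => /andP[qS dsS].
rewrite big_cons conv_Dx.
rewrite -[RHS](IHs S) //; apply: eq_bigr => t _; congr (_ * _).
have eS : S :|: [set:: q :: s] = q |: (S :|: [set:: s]).
  by apply/setP => i; rewrite !inE orbCA.
have qSs : q \notin S :|: [set:: s] by rewrite !inE negb_or qS.
rewrite eS /Dx; case: (k - t)%N => [|l]; first by rewrite !hsub0.
by rewrite hsubU // addrK.
Qed.

Lemma hsub1 p k : hsub [set p] k = 'X_p ^+ k.
Proof.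
elim: k => [|k IHk]; first by rewrite hsub0 expr0.
have := @hsubU set0 p k; rewrite setU0 hsub_set0 add0r inE => -> //.
by rewrite IHk exprS.
Qed.

Definition Cp p : {poly {mpoly int[n]}} :=
  \prod_(q <- rem p (enum 'I_n)) (1 - 'X_q *: 'X).

Lemma conv_Cp p k : conv (Cp p) (hsym_poly n) k = 'X_p ^+ k.
Proof.
rewrite -hsub1 -(@conv_hsub (rem p (enum 'I_n))) ?rem_uniq ?enum_uniq //.
  apply: eq_bigr => t _; congr (_ * _); rewrite -hsubT; congr hsub.
  apply/setP => i; rewrite !inE mem_rem_uniq ?enum_uniq // !inE mem_enum andbT.
  by case: eqP.
rewrite disjoint_sym (@eq_disjoint1 _ p) => [|i]; last by rewrite !inE.
by rewrite mem_rem_uniq ?enum_uniq // !inE eqxx.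
Qed.

Lemma size_Cp p : (size (Cp p) <= n)%N.
Proof.
have H (s : seq 'I_n) : (size (\prod_(q <- s) (1 - 'X_q *: 'X : {poly {mpoly int[n]}}))%R <= (size s).+1)%N.
  elim: s => [|q s IHs]; first by rewrite big_nil size_poly1.
  rewrite big_cons; apply: leq_trans (size_polyMleq _ _) _.
  have : (size (1 - 'X_q *: 'X : {poly {mpoly int[n]}})%R <= 2)%N.
    apply: leq_trans (size_polyD _ _) _; rewrite geq_max size_poly1 size_polyN /=.
    by apply: leq_trans (size_scale_leq _ _) _; rewrite size_polyX.
  move=> s2 /=; have := leq_add s2 IHs; rewrite add2n.
  by case: (_ + _)%N.
apply: leq_trans (H _) _; rewrite size_rem ?mem_enum // size_enum_ord.
by case: n p => [[]|].
Qed.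

End Variables.

Definition hsh (R : pzSemiRingType) (h : nat -> R) a b := if (b <= a)%N then h (a - b)%N else 0.

Definition jacobi_trudi (R : pzRingType) (h : nat -> R) l (lam : seq nat) : 'M[R]_l :=
  \matrix_(i < l, j < l) hsh h (nth 0%N lam i + j)%N i.

Lemma alternantE n lam :
  alternant n lam = \det (\matrix_(p < n, j < n) (Cp p)`_(rev_ord j)) *
    \det (jacobi_trudi (hsym_poly n) n lam).
Proof.
rewrite -[\det (jacobi_trudi _ _ _)]det_tr -det_mulmx; congr (\det _).
apply/matrixP => p i; rewrite !mxE -conv_Cp /conv.
set a := (_ + _)%N.
transitivity (\sum_(t < n) (Cp p)`_t * hsh (hsym_poly n) a t).
  pose N := (n + a.+1)%N.
  rewrite (big_ord_widen N (fun t => (Cp p)`_t * hsym_poly n (a - t))) ?leq_addl //.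
  rewrite (big_ord_widen N (fun t => (Cp p)`_t * hsh (hsym_poly n) a t)) ?leq_addr //.
  rewrite big_mkcond [RHS]big_mkcond; apply: eq_bigr => t _; rewrite ltnS /hsh.
  case: (ltnP t n) => [_|nt]; first by case: ifP; rewrite ?mulr0.
  by rewrite nth_default ?mul0r ?if_same // (leq_trans (size_Cp p)).
rewrite (reindex_inj rev_ord_inj) /=; apply: eq_bigr => j _.
rewrite !mxE /=; congr (_ * _); rewrite /hsh /a.
have lt_i := ltn_ord i; have lt_j := ltn_ord j.
by congr (if _ then hsym_poly n _ else _); lia.
Qed.

Lemma hsym_poly0 n : hsym_poly n 0 = 1.
Proof. by rewrite -hsubT hsub0. Qed.

Lemma det_jacobi_trudi (R : comNzRingType) (h : nat -> R) l lam : h 0%N = 1 -> 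
  (size lam <= l)%N ->
  \det (jacobi_trudi h l lam) = \det (jacobi_trudi h (size lam) lam).
Proof.
move=> h0 /subnK <-; elim: (l - size lam)%N => // d IHd.
rewrite addSn (expand_det_row _ ord_max) (bigD1 ord_max) //= big1 => [|j].
  rewrite addr0 mxE /hsh nth_default ?leq_addl //= add0n subnn h0 mul1r.
  rewrite /cofactor /= -signr_odd addnn odd_double expr0 mul1r -IHd.
  congr (\det _); apply/matrixP => i j; rewrite !mxE.
  by rewrite !lift_max.
rewrite -val_eqE /= => j_neq; rewrite mxE /hsh nth_default ?leq_addl //=.
by rewrite add0n leqNgt ltn_neqAle j_neq -ltnS ltn_ord mul0r.
Qed.

Lemma schur_subproof lam : exists f, is_schur lam f.
Proof.
exists (\det (jacobi_trudi hsym (size lam) lam)) => n le_n.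
rewrite -[symfun_poly _ n]/(symfun_proj n _) -det_map_mx.
have -> : map_mx (symfun_proj n) (jacobi_trudi hsym (size lam) lam) =
          jacobi_trudi (hsym_poly n) (size lam) lam.
  apply/matrixP => i j; rewrite !mxE /hsh; case: ifP => // _.
rewrite [alternant n lam]alternantE [alternant n [::]]alternantE.
rewrite -(det_jacobi_trudi _ le_n) ?hsym_poly0 //.
rewrite (@det_jacobi_trudi _ _ n [::]) ?hsym_poly0 // det_mx00 mulr1.
exact: mulrC.
Qed.

End SchurExistence.

Lemma alternant_nil_neq0 n : alternant n [::] != 0.
Proof.
have -> : alternant n [::] =
    \det (col_perm (perm rev_ord_inj) (Vandermonde n (\row_(i < n) 'X_i))^T).
  by congr (\det _); apply/matrixP => i j; rewrite !mxE permE nth_nil.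
rewrite col_permE det_mulmx det_tr det_Vandermonde det_perm mulf_neq0 ?signr_eq0 //.
apply/prodf_neq0 => i _; apply/prodf_neq0 => j ij; rewrite !mxE subr_eq0.
apply: contraTneq ij => /(congr1 (mcoeff U_(i)%MM)); rewrite !mcoeffXU eqxx.
by case: eqP => [->|//]; rewrite ltnn.
Qed.

Lemma is_schur_inj lam f g : is_schur lam f -> is_schur lam g -> f = g.
Proof.
move=> fP gP; apply: symfun_eqP => n.
have {fP gP} : symfun_poly f (size lam + n) = symfun_poly g (size lam + n).
  apply: (mulIf (alternant_nil_neq0 _)).
  by rewrite (fP _ (leq_addr _ _)) (gP _ (leq_addr _ _)).
elim: (size lam) => // l IHl fg; apply: IHl.
by rewrite -(symfun_poly_restr f) -(symfun_poly_restr g) fg.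
Qed.

Definition schur lam : symfun := sval (cid (schur_subproof lam)).

Lemma schurP lam : is_schur lam (schur lam).
Proof. exact: svalP (cid (schur_subproof lam)). Qed.

Definition staircase k : seq nat := rev (iota 1 k).

End SymmetricFunctions.
Export SymmetricFunctions.

Module RandomHomomorphisms.
Import all_classical all_reals all_analysis.
Local Open Scope classical_set_scope.

Section Definitions.
Context d (T : measurableType d) (R : realType) (P : probability T R).

(* Mutual independence; V carries the discrete sigma-algebra. *)
Definition independent_family (I : eqType) (V : finType) (X : I -> T -> V) :=
  forall (s : seq I) (A : I -> set V), uniq s ->
    P (\bigcap_(i in [set` s]) X i @^-1` A i) =
    (\prod_(i <- s) P (X i @^-1` A i))%E.

Definition uniform_rv (V : finType) (X : T -> V) :=
  forall v, measurable (X @^-1` [set v]) /\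
            P (X @^-1` [set v]) = (#|V|%:R^-1)%:E.

Definition uniform_random_hom (F : finFieldType)
    (phi : T -> {rmorphism symfun -> F}) :=
  let X k w := phi w (hsym k.+1) in
  (forall k, uniform_rv (X k)) /\ independent_family X.

End Definitions.

End RandomHomomorphisms.
Export RandomHomomorphisms.

(* Main.v *)
Require Import Defs.
From mathcomp Require Import all_boot all_algebra.
From mathcomp Require Import mxabelem zify.
From mathcomp Require mpoly.

Set Implicit Arguments.
Unset Strict Implicit.
Unset Printing Implicit Defensive.

Import GRing.Theory.
Local Open Scope ring_scope.

(* By Jacobi-Trudi, s_lambda = det (h_(k - 2i + j)), with 0 <= i, j < k. Write
   the generating series of the h_n as H(t) = a(t^2) (1 + t c(t^2)). The factor
   a(t^2) acts by unitriangular row operations, hence does not affect the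
   determinant, so one may assume a = 1; then half of the columns are unit
   vectors, and what remains is a Hankel matrix in the coefficients of c. As
   (a, c) |-> (h_n) is a bijection, these coefficients are uniform, and it is
   enough to see that a fraction 1/q of the n x n Hankel matrices is singular.
   Let r and r' be the ranks of the n x n and (n-1) x (n+1) Hankel matrices of a
   sequence g. Then r' = min (r, n-1), since the left kernels K_a of the
   a x (2n - a) Hankel matrices satisfy 'X * K_a + K_a <= K_(a+1). So q^(n-r)
   and q^(n-1-r') determine whether g is singular; both are numbers of solutions u
   of u H = 0, and their sums over g follow by counting, for each u, the g that
   solve this equation. *)

(** * Ranks of Hankel matrices *)

Definition hankel (F : Type) (g : nat -> F) a b : 'M[F]_(a, b) :=
  \matrix_(i < a, j < b) g (i + j)%N.

Lemma trmx_hankel (F : Type) (g : nat -> F) a b : (hankel g a b)^T = hankel g b a.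
Proof. by apply/matrixP => i j; rewrite !mxE addnC. Qed.

Lemma mulmx_rowsub1 (R : pzSemiRingType) m a b (f : 'I_a -> 'I_b) (v : 'M[R]_(m, a)) i j :
  injective f -> (v *m rowsub f 1%:M) i (f j) = v i j.
Proof.
move=> f_inj; rewrite mxE (bigD1 j) //= big1 => [|l lj].
  by rewrite !mxE eqxx mulr1 addr0.
by rewrite !mxE (inj_eq f_inj) (negPf lj) mulr0.
Qed.

Section HankelRank.
Variables (F : fieldType) (g : nat -> F).

(* Read row vectors as polynomials: if V is the left kernel of H_(a, b+1), then
   V and 'X * V lie in the left kernel of H_(a+1, b), and 'X * V is not
   contained in V because multiplication by 'X raises the degree. *)
Lemma hankel_ker_step a b : (\rank (hankel g a b.+1) < a)%N ->
  (a - \rank (hankel g a b.+1) < a.+1 - \rank (hankel g a.+1 b))%N.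
Proof.
set H := hankel g a b.+1; set H' := hankel g a.+1 b => ltr.
pose K := kermx H.
(* [E0] appends a zero coordinate and [E1] prepends one: on polynomials, the inclusion and
   multiplication by 'X. *)
pose E0 : 'M[F]_(a, a.+1) := rowsub (lift ord_max) 1%:M.
pose E1 : 'M[F]_(a, a.+1) := rowsub (lift ord0) 1%:M.
have E0m m (v : 'M[F]_(m, a)) i : (v *m E0) i ord_max = 0.
  by rewrite mxE big1 // => l _; rewrite !mxE eq_sym (negPf (neq_lift _ _)) mulr0.
have E0_free : row_free E0.
  apply: inj_row_free => v /matrixP v0; apply/matrixP => i j.
  by rewrite -(mulmx_rowsub1 _ _ _ (@lift_inj _ ord_max)) v0 !mxE.
have KX f f' : rowsub f H' = colsub f' H -> (K *m rowsub f 1%:M <= kermx H')%MS.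
  move=> ff'; apply/sub_kermxP; rewrite -mulmxA -rowsubE ff'.
  by rewrite mulmx_colsub mulmx_ker; apply/matrixP => i j; rewrite !mxE.
have K0 : (K *m E0 <= kermx H')%MS.
  apply: (KX _ (lift ord_max)); apply/matrixP => i j.
  by rewrite !mxE !lift_max.
have K1 : (K *m E1 <= kermx H')%MS.
  apply: (KX _ (lift ord0)); apply/matrixP => i j.
  by rewrite !mxE !lift0 addSn addnS.
rewrite -!mxrank_ker -/K -(mxrankMfree K E0_free) ltn_neqAle mxrankS // andbT.
rewrite (mxrank_leqif_sup K0); apply/negP => /(submx_trans K1) K10.
(* If 'X * K lies in K, then v_i is coordinate i + 1 of another element of K, or 0 when i is the
   last index; descending on i gives K = 0. *)
have top d (v : 'rV_a) (i : 'I_a) : (v <= K)%MS -> (a - i <= d)%N -> v 0 i = 0.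
  elim: d v i => [|d IHd] v i vK; first by have := ltn_ord i; lia.
  move=> le_d; have /submxP[w vE] := submx_trans (submxMr E1 vK) K10.
  rewrite -(mulmx_rowsub1 _ _ _ (@lift_inj _ ord0)) -/E1 vE mulmxA.
  case: (unliftP ord_max (lift ord0 i)) => [j|-> //] ij.
  rewrite ij mulmx_rowsub1; last exact: lift_inj.
  apply: IHd; first exact: submxMl.
  by move/(congr1 (@nat_of_ord _)): ij; rewrite lift0 lift_max => ij; lia.
have K_eq0 : K = 0.
  apply/row_matrixP => l; rewrite row0; apply/rowP => i.
  by rewrite (top a) ?mxE ?row_sub ?leq_subr.
by move: (mxrank_ker H); rewrite -/K K_eq0 mxrank0; lia.
Qed.

(** The kernel step from n to n + 1 rows and the one from n + 1 to n + 2 rows give the two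
    inequalities; transposition identifies the outer two ranks. *)
Lemma rank_hankel n :
  \rank (hankel g n n.+2) = minn (\rank (hankel g n.+1 n.+1)) n.
Proof.
have r1 := rank_leq_row (hankel g n n.+2).
have r2 := rank_leq_row (hankel g n.+1 n.+1).
have r3 : \rank (hankel g n.+2 n) = \rank (hankel g n n.+2).
  by rewrite -mxrank_tr trmx_hankel.
have := @hankel_ker_step n n.+1; have := @hankel_ker_step n.+1 n.
rewrite r3; lia.
Qed.
End HankelRank.

Lemma card_ker (F : finFieldType) m n (A : 'M[F]_(m, n)) :
  #|[set u : 'rV_m | u *m A == 0]| = (#|F| ^ (m - \rank A))%N.
Proof.
rewrite -mxrank_ker -card_rowg; apply: eq_card => u.
by rewrite !inE; apply/eqP/sub_kermxP.
Qed.

(** * Counting singular Hankel matrices over a finite field *)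

Section HankelCount.
Variable F : finFieldType.
Local Notation q := #|F|.

Definition hankelv N (c : 'rV[F]_N) a b := hankel (nth 0 (rVpoly c)) a b.

(** The equation is linear in c, with matrix [T]. The transpose of [T] multiplies polynomials by u,
    hence is injective, and [T] has rank b. *)
Lemma card_hankel_ker1 N a b (u : 'rV[F]_a) : u != 0 -> (a + b <= N.+1)%N ->
  #|[set c : 'rV_N | u *m hankelv c a b == 0]| = (q ^ (N - b))%N.
Proof.
move=> u0 abN.
have rVpolyE d (v : 'rV[F]_d) : rVpoly v = \sum_(i < d) v 0 i *: 'X^i.
  rewrite -[v in LHS]rVpolyK /rVpoly poly_def; apply: eq_bigr => i _.
  by rewrite rVpolyK valK.
pose T : 'M[F]_(N, b) := \matrix_(s, j) \sum_(i < a) u 0 i * (val s == i + j)%N%:R.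
have TE c : u *m hankelv c a b = c *m T.
  apply/rowP => j; rewrite !mxE.
  under [RHS]eq_bigr => s _ do rewrite mxE big_distrr /=.
  rewrite exchange_big; apply: eq_bigr => i _ /=; rewrite mxE.
  have ijN : (i + j < N)%N by have := ltn_ord i; have := ltn_ord j; lia.
  rewrite (bigD1 (Ordinal ijN)) //= eqxx big1 => [|s].
    by rewrite -(coef_rVpoly_ord c (Ordinal ijN)) /= addr0 mulr1 mulrC.
  by rewrite -val_eqE /= => /negPf ->; rewrite !mulr0.
have rT : \rank T = b.
  rewrite -mxrank_tr; apply/eqP/inj_row_free => w wT.
  have wu0 : rVpoly w * rVpoly u = 0.
    apply/polyP => s; rewrite coef0 !rVpolyE mulr_suml coef_sum.
    under eq_bigr => j _ do rewrite mulr_sumr coef_sum.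
    under eq_bigr => j _.
      under eq_bigr => i _.
        rewrite -scalerAl -scalerAr -exprD !coefZ coefXn.
        over.
      over.
    (* The product has degree at most a + b - 2 < N, so [T] sees all its coefficients. *)
    have [sN|Ns] := ltnP s N; last first.
      rewrite big1 // => j _; rewrite big1 // => i _.
      have [sij|_] := eqVneq s (j + i)%N; last by rewrite !mulr0.
      by have := ltn_ord i; have := ltn_ord j; lia.
    have /rowP/(_ (Ordinal sN)) := wT; rewrite !mxE => wTs.
    rewrite -[RHS]wTs; apply: eq_bigr => j _; rewrite !mxE mulr_sumr.
    by apply: eq_bigr => i _; rewrite addnC.
  have /eqP := wu0; rewrite mulf_eq0 => /orP[]/eqP v0.
    by rewrite -[w]rVpolyK v0 raddf0.
  by move: u0; rewrite -[u]rVpolyK v0 raddf0 eqxx.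
transitivity (q ^ (N - \rank T))%N; last by rewrite rT.
rewrite -card_ker; apply: eq_card => c.
by rewrite !inE TE.
Qed.

(** Count the pairs (c, u) by u: u = 0 contributes q^N, every other u contributes q^(N-b). The extra
    summand on the left avoids a subtraction. *)
Lemma card_hankel_ker N a b : (a + b <= N.+1)%N ->
  (\sum_(c : 'rV[F]_N) q ^ (a - \rank (hankelv c a b)) + q ^ (N - b) =
   q ^ N + q ^ a * q ^ (N - b))%N.
Proof.
move=> abN.
under eq_bigr => c _ do rewrite -card_ker -sum1dep_card.
rewrite (exchange_big_dep xpredT) //=.
under eq_bigr => u _ do rewrite sum1dep_card.
rewrite (bigD1 0) //=.
under eq_bigr => u u0 do rewrite card_hankel_ker1 //.
rewrite sum_nat_const (_ : #|[set x | _]| = q ^ N)%N; last first.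
  transitivity #|{: 'rV[F]_N}|; last by rewrite card_mx mul1n.
  apply: eq_card => c.
  by rewrite !inE mul0mx eqxx.
rewrite (_ : #|(fun i => i != 0)| = (q ^ a).-1); last first.
  by have := cardC1 (0 : 'rV[F]_a); rewrite card_mx mul1n.
have qa : (0 < q ^ a)%N by rewrite expn_gt0 (ltnW (card_finNzRing_gt1 F)).
by rewrite -addnA addnC -mulSnr (prednK qa) addnC.
Qed.

(** N may exceed 2n - 1: for even k, the staircase leaves the last coordinate of c out of the
    matrix. *)
Lemma card_singular_hankel N n : (0 < n)%N -> (n.*2 <= N.+1)%N ->
  #|[set c : 'rV[F]_N | \det (hankelv c n n) == 0]| = (q ^ N.-1)%N.
Proof.
case: n => // n _ nN.
have q1 : (1 < q)%N := card_finNzRing_gt1 F.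
(* Summing this identity over c turns both ranks into the kernel counts above. *)
have pt (c : 'rV[F]_N) : (q ^ (n.+1 - \rank (hankelv c n.+1 n.+1)) + q =
    q.-1 * (\det (hankelv c n.+1 n.+1) == 0)%R + 1 +
    q * q ^ (n - \rank (hankelv c n n.+2)))%N.
  rewrite rank_hankel.
  have := rank_leq_row (hankelv c n.+1 n.+1).
  have := row_free_unit (hankelv c n.+1 n.+1).
  rewrite /row_free unitmxE unitfE => /(congr1 negb); rewrite negbK => <-.
  (* At full rank both sides are 1 + q; otherwise the minimum is the rank and the indicator makes
     the constant on the right q. *)
  rewrite leq_eqVlt => /predU1P[->|lt_r].
    rewrite eqxx subnn (_ : n - minn n.+1 n = 0)%N; last by lia.
    by rewrite expn0 muln0 muln1 addnC.
  rewrite (minn_idPl _) // -expnS -subSn // (ltn_eqF lt_r) /=.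
  by rewrite muln1 addn1 prednK ?(ltnW q1) // addnC.
set s := #|_|.
have sE : s = (\sum_(c : 'rV[F]_N) (\det (hankelv c n.+1 n.+1) == 0)%R)%N.
  by rewrite /s -sum1dep_card big_mkcond; apply: eq_bigr => c _; case: eqP.
have cN : #|'rV[F]_N| = (q * q ^ N.-1)%N.
  by rewrite card_mx mul1n -expnS prednK //; lia.
have sum_pt : (\sum_(c : 'rV[F]_N) (q ^ (n.+1 - \rank (hankelv c n.+1 n.+1)) + q) =
    \sum_(c : 'rV[F]_N) (q.-1 * (\det (hankelv c n.+1 n.+1) == 0)%R + 1 +
    q * q ^ (n - \rank (hankelv c n n.+2))))%N.
  by apply: eq_bigr => c _; apply: pt.
move: sum_pt; rewrite !big_split /= -!big_distrr /= -sE !sum_nat_const cN muln1.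
have := @card_hankel_ker N n.+1 n.+1; have := @card_hankel_ker N n n.+2.
set A := (\sum_c _)%N; set B := (\sum_c _)%N.
set y := (q ^ (N - n.+1))%N.
have yE : (q ^ n * y = q ^ N.-1)%N.
  by rewrite -expnD; congr (_ ^ _)%N; lia.
have NE : (q ^ N = q * q ^ N.-1)%N by rewrite -expnS prednK //; lia.
move=> HA HB; rewrite expnS -mulnA yE in HB.
have qA : (q * A + y = q * (q * q ^ N.-1) + q ^ N.-1)%N.
  (* For n = 0, N may be 1, and truncation in N - n.+2 breaks [yS] below; there the kernel terms
     cancel and A = q^N. *)
  have [n0|n0] := posnP n.
    move: HA yE; rewrite n0 expn0 !mul1n => /(_ _)/addIn -> => [->|]; last by lia.
    by rewrite NE.
  have yS : (q * q ^ (N - n.+2) = y)%N by rewrite -expnS; congr (_ ^ _)%N; lia.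
  have := congr1 (muln q) (HA _); rewrite !mulnDr yS.
  rewrite mulnCA yS yE => -> //; last by lia.
  by rewrite NE.
rewrite NE in HB * => sum_pt.
apply/eqP; rewrite -(@eqn_pmul2l q.-1) ?ltn_predRL //; apply/eqP.
have -> : (q.-1 * q ^ N.-1 = q * q ^ N.-1 - q ^ N.-1)%N by rewrite -subn1 mulnBl mul1n.
(* With Qi = q^(N-1+i): B + y = 2 Q1, Y + y = Q2 + Q0 and B + Q2 = X + Q1 + Y, whence X = Q1 -
   Q0. *)
move: (HB ltac:(lia)) sum_pt qA; rewrite [(_ * q)%N]mulnC.
move: (q * (q * q ^ N.-1))%N => Q2; move: (q * q ^ N.-1)%N => Q1.
move: (q.-1 * s)%N (q * A)%N (q ^ N.-1)%N => X Y Q0; lia.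
Qed.
End HankelCount.

(** * From the staircase determinant to a Hankel determinant *)

Lemma jacobi_trudi_staircaseE (R : pzRingType) (h : nat -> R) k (i j : 'I_k) :
  jacobi_trudi h k (staircase k) i j = hsh h (k + j) i.*2.
Proof.
have ltik := ltn_ord i; rewrite mxE /staircase nth_rev size_iota // nth_iota; last by lia.
rewrite /hsh (_ : (i <= _)%N = (i.*2 <= k + j)%N); last by lia.
by congr (if _ then h _ else _); lia.
Qed.

(* If H(t) = \sum_n h_n t^n, this is the coefficient sequence of a(t^2) H(t). *)
Definition even_conv (R : pzRingType) (a h : nat -> R) n :=
  \sum_(t < n./2.+1) a t * h (n - t.*2)%N.

(** The coefficients of 1 + t c(t^2). *)
Definition odd_series (R : pzRingType) (c : nat -> R) n :=
  if odd n then c n./2 else (n == 0)%:R.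

Lemma even_conv_double (R : pzRingType) (a c : nat -> R) m :
  even_conv a (odd_series c) m.*2 = a m.
Proof.
rewrite /even_conv doubleK big_ord_recr /= subnn /odd_series mulr1 big1 ?add0r //.
move=> t _; rewrite -doubleB odd_double double_eq0.
by rewrite subn_eq0 leqNgt ltn_ord mulr0.
Qed.

Lemma even_conv_double1 (R : pzRingType) (a c : nat -> R) m :
  even_conv a (odd_series c) m.*2.+1 = \sum_(t < m.+1) a t * c (m - t)%N.
Proof.
rewrite /even_conv /= uphalf_double; apply: eq_bigr => t _; congr (_ * _).
have le_tm : (t <= m)%N by rewrite -ltnS.
rewrite subSn ?leq_double // -doubleB /odd_series /= odd_double /=.
by rewrite uphalf_double.
Qed.

(* The even part of the generating series acts on the Jacobi-Trudi matrix of a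
   staircase as a unitriangular row operation: each row shifts the indices by 2. *)
Lemma det_staircase_even_conv (R : comNzRingType) (a h : nat -> R) k : a 0%N = 1 ->
  \det (jacobi_trudi (even_conv a h) k (staircase k)) =
  \det (jacobi_trudi h k (staircase k)).
Proof.
move=> a0; pose U : 'M[R]_k := \matrix_(i, l) hsh a l i.
have -> : jacobi_trudi (even_conv a h) k (staircase k) =
          U *m jacobi_trudi h k (staircase k).
  apply/matrixP => i j; rewrite jacobi_trudi_staircaseE !mxE.
  under [RHS]eq_bigr => l _ do rewrite mxE jacobi_trudi_staircaseE.
  have ltik := ltn_ord i; have ltjk := ltn_ord j.
  pose f l := hsh a l i * hsh h (k + j) l.*2.
  have shift := big_addn 0 k i xpredT f; rewrite add0n in shift.
  rewrite -(big_mkord xpredT f).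
  rewrite (big_cat_nat (n := i)) //=; last exact: ltnW.
  rewrite big_nat big1 ?add0r => [|l /andP[_ li]]; last first.
    by rewrite /f /hsh leqNgt li mul0r.
  rewrite shift /f [in LHS]/hsh; case: leqP => [le_i|lt_i]; last first.
    rewrite big1 // => l _; rewrite {2}/hsh leqNgt (_ : (_ < _)%N) ?mulr0 //.
    by rewrite (leq_trans lt_i) // leq_double leq_addl.
  set n := (k + j - i.*2)%N; rewrite /even_conv.
  (* As j < k, n./2 < k - i: the matrix is wide enough to hold the whole convolution, and later
     terms have a negative index in [h]. *)
  rewrite (big_cat_nat (n := n./2.+1)) //=; last by rewrite /n; lia.
  rewrite [X in _ + X]big_nat [X in _ + X]big1 ?addr0 => [|l ltl]; last first.
    rewrite /hsh [in X in _ * X]ifN ?mulr0 // -ltnNge; move: ltl; rewrite /n; lia.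
  rewrite big_mkord; apply: eq_bigr => -[t /= ltt] _.
  have {ltt} le_tn : (t.*2 <= n)%N by lia.
  rewrite /hsh leq_addl addnK ifT; last by rewrite doubleD addnC -leq_subRL.
  by rewrite doubleD [(t.*2 + _)%N]addnC subnDA.
rewrite det_mulmx -[\det U]det_tr det_trig.
  by rewrite big1 ?mul1r // => i _; rewrite !mxE /hsh leqnn subnn.
by apply/is_trig_mxP => i l il; rewrite !mxE /hsh leqNgt il.
Qed.

(** The columns j with k + j even are the unit vectors at the rows (k + j)/2, which run from uphalf
    k to k - 1, so left kernel vectors are supported on the first uphalf k rows. There the remaining
    columns j = k - 1 - 2l form the Hankel matrix. Comparing kernels avoids the signs of a column
    permutation. *)
Lemma staircase_hankel (F : fieldType) (c : nat -> F) k :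
  (\det (jacobi_trudi (odd_series c) k (staircase k)) == 0) =
  (\det (hankel (fun s => c (k.-1 - s)%N) (uphalf k) (uphalf k)) == 0).
Proof.
set M := jacobi_trudi _ _ _; set n := uphalf k; set H := hankel _ _ _.
have [nk kn] : (n.*2 <= k.+1 /\ k <= n.*2)%N by lia.
clearbody n; have le_nk : (n <= k)%N by lia.
pose w (i : 'I_n) : 'I_k := widen_ord le_nk i.
have Mhankel (i l : 'I_n) (j : 'I_k) : (j + l.*2 = k.-1)%N -> M (w i) j = H i l.
  move=> jl; have lti := ltn_ord i; have ltl := ltn_ord l.
  rewrite jacobi_trudi_staircaseE !mxE /hsh /= ifT; last by lia.
  have le_il : (i + l <= k.-1)%N by lia.
  have -> : (k + j - i.*2 = (k.-1 - (i + l)).*2.+1)%N by have := ltn_ord j; lia.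
  by rewrite /odd_series /= odd_double uphalf_double.
have Mdelta (i j : 'I_k) : ~~ odd (k + j) -> M i j = ((k + j)./2 == i)%:R.
  move=> od; rewrite jacobi_trudi_staircaseE /hsh /odd_series.
  case: leqP => [le_i|lt_i]; last by case: eqP => // ?; lia.
  by rewrite oddB // odd_double addbF (negPf od); congr _%:R; lia.
clearbody M H.
have sum_w (v : 'rV[F]_k) j : (forall i : 'I_k, (n <= i)%N -> v 0 i = 0) ->
    (v *m M) 0 j = \sum_(i < n) v 0 (w i) * M (w i) j.
  move=> v0; rewrite mxE (bigID (fun i : 'I_k => (i < n)%N)) /=.
  rewrite big_ord_narrow [X in _ + X]big1 ?addr0 // => i.
  by rewrite -leqNgt => /v0 ->; rewrite mul0r.
apply/det0P/det0P => -[v v_neq0 vM].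
  have v0 (i : 'I_k) : (n <= i)%N -> v 0 i = 0.
    move=> le_ni; have lti := ltn_ord i.
    (* Column 2i - k is the unit vector at row i. *)
    have ltj : (i.*2 - k < k)%N by lia.
    have /rowP/(_ (Ordinal ltj)) := vM; rewrite !mxE => <-.
    have kj : (k + (i.*2 - k) = i.*2)%N by lia.
    rewrite (bigD1 i) //= big1 => [|l li]; rewrite Mdelta /= kj ?odd_double ?doubleK //.
      by rewrite eqxx mulr1 addr0.
    by rewrite (inj_eq val_inj) eq_sym (negPf li) mulr0.
  exists (\row_i v 0 (w i)).
    apply: contra v_neq0 => /eqP/rowP w0; apply/eqP/rowP => i; rewrite mxE.
    have [lt_in|] := ltnP i n; last exact: v0.
    have := w0 (Ordinal lt_in); rewrite !mxE => <-.
    by congr (v _ _); apply: val_inj.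
  apply/rowP => l; have ltl := ltn_ord l.
  have ltj : (k.-1 - l.*2 < k)%N by lia.
  have jl : (Ordinal ltj + l.*2 = k.-1)%N by rewrite /=; lia.
  have := sum_w _ (Ordinal ltj) v0; rewrite vM !mxE => vMj.
  rewrite [RHS]vMj.
  by apply: eq_bigr => i _; rewrite (Mhankel _ _ _ jl) mxE.
(* Coefficients past the length of v are 0, so this pads v with zeros. *)
pose u : 'rV[F]_k := \row_i (rVpoly v)`_i.
have uw i : u 0 (w i) = v 0 i by rewrite mxE /= coef_rVpoly_ord.
have u0 (i : 'I_k) : (n <= i)%N -> u 0 i = 0.
  by move=> le_ni; rewrite mxE nth_default // (leq_trans (size_poly _ _)).
exists u.
  apply: contra v_neq0 => /eqP u_eq0; apply/eqP/rowP => i.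
  by rewrite -uw u_eq0 !mxE.
apply/rowP => j; rewrite sum_w // mxE.
have ltj := ltn_ord j; have [od|ev] := boolP (odd (k + j)).
  have ltl : ((k.-1 - j)./2 < n)%N by lia.
  have jl : (j + (Ordinal ltl).*2 = k.-1)%N by rewrite /=; lia.
  have /rowP/(_ (Ordinal ltl)) := vM; rewrite !mxE => vMl.
  rewrite -[RHS]vMl; apply: eq_bigr => i _.
  by rewrite uw (Mhankel _ _ _ jl).
rewrite big1 // => i _; rewrite Mdelta // (_ : _ == _ = false) ?mulr0 //.
by apply/eqP; have := ltn_ord i; rewrite /=; lia.
Qed.

(** * Counting the zeros of the staircase determinant *)

Section StaircaseCount.
Variable F : finFieldType.

(* The row vector x lists h_1, ..., h_N. *)
Definition hseq N (x : 'rV[F]_N) n := if n is n'.+1 then (rVpoly x)`_n' else 1.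

(** The largest index that occurs is 2k - 1, at i = 0 and j = k - 1. *)
Lemma jacobi_trudi_staircase_eq (R : pzRingType) (h h' : nat -> R) k :
  (forall n, (n < k.*2)%N -> h n = h' n) ->
  jacobi_trudi h k (staircase k) = jacobi_trudi h' k (staircase k).
Proof.
move=> hh'; apply/matrixP => i j; rewrite !jacobi_trudi_staircaseE /hsh.
by case: ifP => // _; apply: hh'; have := ltn_ord j; have := ltn_ord i; lia.
Qed.

(* The first component is read backwards, so that staircase_hankel yields the
   Hankel matrix of this vector itself. *)
Definition staircase_param k (p : 'rV[F]_k * 'rV[F]_k.-1) : 'rV[F]_(k.*2.-1) :=
  \row_j even_conv (hseq p.2) (odd_series (fun m => (rVpoly p.1)`_(k.-1 - m))) j.+1.

Lemma hseq_staircase_param k (p : 'rV[F]_k * 'rV[F]_k.-1) n : (n < k.*2)%N ->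
  hseq (staircase_param p) n =
  even_conv (hseq p.2) (odd_series (fun m => (rVpoly p.1)`_(k.-1 - m))) n.
Proof.
case: n => [_|n ltn].
  by rewrite -[X in even_conv _ _ X]double0 even_conv_double.
have ltn' : (n < k.*2.-1)%N by lia.
by rewrite /= (coef_rVpoly_ord _ (Ordinal ltn')) mxE.
Qed.

(** The even coefficients are those of a. As a_0 = 1, coefficient 2m + 1 then yields c_m from the
    earlier c's. *)
Lemma staircase_param_inj k : injective (@staircase_param k).
Proof.
move=> [c a] [c' a'] cc'.
have hE n : (n < k.*2)%N ->
    even_conv (hseq a) (odd_series (fun m => (rVpoly c)`_(k.-1 - m))) n =
    even_conv (hseq a') (odd_series (fun m => (rVpoly c')`_(k.-1 - m))) n.
  move=> ltn; rewrite -[LHS](@hseq_staircase_param k (c, a)) //.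
  by rewrite -[RHS](@hseq_staircase_param k (c', a')) // cc'.
have aa' : a = a'.
  apply/rowP => i; have := hE i.+1.*2; rewrite !even_conv_double /=.
  by rewrite !coef_rVpoly_ord; apply; have := ltn_ord i; lia.
rewrite aa' in hE *; congr (_, _); apply/rowP => i.
have lt_ik := ltn_ord i.
suff cE m : (m < k)%N -> (rVpoly c)`_(k.-1 - m) = (rVpoly c')`_(k.-1 - m).
  have := cE (k.-1 - i)%N; rewrite subKn; last by lia.
  by rewrite !coef_rVpoly_ord; apply; lia.
elim/ltn_ind: m => m IHm ltm.
have := hE m.*2.+1; rewrite !even_conv_double1 => /(_ ltac:(lia)).
rewrite !big_ord_recl /= !mul1r !subn0.
rewrite [X in _ + X = _](eq_bigr (fun t : 'I_m =>
    (rVpoly a')`_t * (rVpoly c')`_(k.-1 - (m - t.+1)))); first exact: addIr.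
by move=> t _; have ltt := ltn_ord t; rewrite IHm /bump ?add1n //; lia.
Qed.

(** The parametrization is bijective since k + (k - 1) = 2k - 1. Vanishing constrains its first
    component only, which leaves q^(k-1) choices for each component. *)
Lemma card_staircase_zeros k : (0 < k)%N ->
  #|[set x : 'rV[F]_(k.*2.-1) | \det (jacobi_trudi (hseq x) k (staircase k)) == 0]| =
  (#|F| ^ k.*2.-2)%N.
Proof.
move=> k_gt0.
pose Z := [set x : 'rV[F]_(k.*2.-1) | \det (jacobi_trudi (hseq x) k (staircase k)) == 0].
have param_bij : bijective (@staircase_param k).
  apply: inj_card_bij; first exact: staircase_param_inj.
  by rewrite card_prod !card_mx -expnD leq_exp2l ?card_finNzRing_gt1 //; lia.
rewrite -(on_card_preimset (onW_bij _ param_bij)).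
have -> : @staircase_param k @^-1: Z = finset.setX
    [set c : 'rV[F]_k | \det (hankelv c (uphalf k) (uphalf k)) == 0] [set: 'rV[F]_k.-1].
  apply/setP => -[c a]; rewrite !inE andbT.
  rewrite (jacobi_trudi_staircase_eq (hseq_staircase_param (c, a))).
  rewrite det_staircase_even_conv // staircase_hankel.
  congr (\det _ == 0); apply/matrixP => i j; rewrite !mxE.
  by rewrite subKn //; have := ltn_ord i; have := ltn_ord j; lia.
rewrite cardsX cardsT card_singular_hankel ?card_mx ?mul1n -?expnD; try lia.
by congr (_ ^ _)%N; lia.
Qed.
End StaircaseCount.

(** * Images of Schur functions under ring homomorphisms *)

Module Schur.
Import mpoly.

(** [schur] is chosen from an existence statement; uniqueness identifies it with the determinant. *)
Lemma schurE lam : schur lam = \det (jacobi_trudi hsym (size lam) lam).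
Proof.
apply: is_schur_inj (@schurP lam) _ => n le_n.
rewrite -[symfun_poly _ n]/(symfun_proj n _) -det_map_mx.
have -> : map_mx (symfun_proj n) (jacobi_trudi hsym (size lam) lam) =
          jacobi_trudi (hsym_poly n) (size lam) lam.
  by apply/matrixP => i j; rewrite !mxE /hsh; case: ifP.
rewrite !alternantE (@det_jacobi_trudi _ _ n [::]) ?hsym_poly0 // det_mx00 mulr1.
by rewrite (det_jacobi_trudi _ le_n) ?hsym_poly0 // mulrC.
Qed.

Lemma hsym0 : hsym 0 = 1.
Proof. by apply: symfun_eqP => n; rewrite /= hsym_poly0. Qed.

Lemma rmorph_schur (R : comNzRingType) (f : {rmorphism symfun -> R}) lam :
  f (schur lam) = \det (jacobi_trudi (fun n => f (hsym n)) (size lam) lam).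
Proof.
rewrite schurE -det_map_mx; congr (\det _); apply/matrixP => i j.
by rewrite !mxE /hsh; case: ifP => // _; rewrite raddf0.
Qed.

End Schur.
Import Schur.

(* From counting to probability *)
From mathcomp Require Import all_classical all_reals all_analysis.

Local Open Scope classical_set_scope.
Local Open Scope ring_scope.

(** The event is a disjoint union of the sets [E x], each an intersection of N independent events of
    probability 1/#|V|. *)
Lemma uniform_independent_prob d (T : measurableType d) (R : realType)
    (P : probability T R) (V : finType) (X : nat -> T -> V) N (Q : pred {ffun 'I_N -> V}) :
  (forall k, uniform_rv P (X k)) -> independent_family P X ->
  P [set w | Q [ffun j : 'I_N => X j w]] = (#|Q|%:R / (#|V| ^ N)%:R)%:E.
Proof.
move=> uX iX.
pose E (x : {ffun 'I_N -> V}) := [set w | [ffun j : 'I_N => X j w] = x].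
(* Independence is indexed by all naturals, so this must be defined for i >= N too, where it is the
   full set. *)
pose A (x : {ffun 'I_N -> V}) i := [set v | forall lt_iN : (i < N)%N, v = x (Ordinal lt_iN)].
have EE x : E x = \bigcap_(i in [set` iota 0 N]) X i @^-1` A x i.
  apply/seteqP; split => w /=.
    by move=> <- i _ lt_iN /=; rewrite ffunE.
  move=> wx; apply/ffunP => j; rewrite ffunE.
  have jN : val j \in iota 0 N by rewrite mem_iota add0n ltn_ord.
  rewrite (wx _ jN (ltn_ord j)); congr (x _); exact: val_inj.
have preE x (j : 'I_N) : X j @^-1` A x j = X j @^-1` [set x j].
  apply/seteqP; split => w /=.
    by move/(_ (ltn_ord j)) ->; congr (x _); apply: val_inj.
  by move=> -> lt; congr (x _); apply: val_inj.
have PE x : P (E x) = ((#|V| ^ N)%:R^-1)%:E.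
  rewrite EE iX ?iota_uniq // -val_enum_ord big_map.
  under eq_bigr => j _ do rewrite preE (uX j (x j)).2.
  by rewrite prodEFin big_enum prodr_const card_ord natrX exprVn.
have mE x : measurable (E x).
  rewrite EE; apply: fin_bigcap_measurable; first exact: finite_seq.
  move=> i /=; rewrite mem_iota add0n => /= lt_i.
  by rewrite (preE x (Ordinal lt_i)); case: (uX i (x (Ordinal lt_i))).
have -> : [set w | Q [ffun j : 'I_N => X j w]] = \bigcup_(x in [set` enum Q]) E x.
  apply/seteqP; split => [w Qw|w [x /= Qx Ex]] /=.
    by exists [ffun j : 'I_N => X j w] => //; rewrite /= mem_enum; exact: Qw.
  by move: Qx; rewrite mem_enum -Ex.
rewrite measure_fin_bigcup //; last first.
  by move=> x y _ _ [w [/= <- <-]].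
rewrite -fsbig_seq ?enum_uniq //=.
under eq_bigr => x _ do rewrite PE.
by rewrite sumEFin big_enum sumr_const mulr_natl.
Qed.

Theorem theorem6p5 (d : measure_display) (T : measurableType d) (R : realType)
    (P : probability T R) (q : nat) (F : finFieldType)
    (phi : T -> {rmorphism symfun -> F}) (k : nat) :
  #|F| = q -> (1 <= k)%N -> uniform_random_hom P phi ->
  P [set w | phi w (schur (staircase k)) = 0] = (q%:R^-1)%:E.
Proof.
move=> <- k_gt0 [unifX indepX].
pose N := k.*2.-1.
(* Here [x j] stands for the image of h_(j+1). *)
pose Q (x : {ffun 'I_N -> F}) :=
  \det (jacobi_trudi (hseq (\row_j x j)) k (staircase k)) == 0.
have -> : [set w | phi w (schur (staircase k)) = 0] =
    [set w | Q [ffun j : 'I_N => phi w (hsym j.+1)]].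
  apply/seteqP; suff schurQ w : (phi w (schur (staircase k)) == 0) =
      Q [ffun j : 'I_N => phi w (hsym j.+1)].
    by split=> w /=; rewrite -schurQ => /eqP.
  rewrite rmorph_schur size_rev size_iota /Q; congr (\det _ == 0).
  apply: jacobi_trudi_staircase_eq => -[_|n ltn] /=; first by rewrite hsym0 rmorph1.
  have ltnN : (n < N)%N by rewrite /N; lia.
  by rewrite (coef_rVpoly_ord _ (Ordinal ltnN)) mxE ffunE.
rewrite (uniform_independent_prob Q unifX indepX).
have -> : #|Q| = (#|F| ^ k.*2.-2)%N.
  rewrite -(@card_staircase_zeros F k) //.
  pose g (x : {ffun 'I_N -> F}) : 'rV[F]_N := \row_j x j.
  have g_bij : bijective g.
    exists (fun x : 'rV[F]_N => [ffun j => x ord0 j]) => x.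
      by apply/ffunP => j; rewrite ffunE mxE.
    by apply/rowP => j; rewrite mxE ffunE.
  rewrite -(on_card_preimset (onW_bij _ g_bij)); apply: eq_card => x.
  by rewrite !inE.
have q_neq0 : (#|F|%:R : R) != 0.
  by rewrite Num.Theory.pnatr_eq0 -lt0n (ltnW (card_finNzRing_gt1 F)).
have -> : N = k.*2.-2.+1 by rewrite /N; lia.
by rewrite !natrX exprS invfM mulrCA divff ?mulr1 // expf_neq0.
Qed.
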